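(* For every integer $n\ge 3$ there is a relatively closed set $S\subset E^n$ with the following properties: (i) $\operatorname{int}S=\varnothing$ and $S$ does not separate domains in $E^n$; (ii) for $1\le j\le n$ let $S_j$ denote the set of all $(a',a'')\in E^{j-1}\times E^{n-j}$ such that $\operatorname{int}_{\mathbb{C}}S(a',\cdot,a'')\neq\varnothing$, and define $$T:=\bigcup_{j=1}^n\{(z',z_j,z'')\in E^{j-1}\times E\times E^{n-j}:\ (z',z'')\notin S_j\};$$ then there is a function $f:T\setminus S\to\mathbb{C}$ which is separately holomorphic on $T$ and such that there is no function $\hat f\in\mathcal{M}(E^n)$ with $\hat f=f$ on $T\setminus S$.
   Context: $E$ denotes the open unit disc of $\mathbb{C}$ and $\mathcal{M}(\Omega)$ the space of meromorphic functions on $\Omega$. For $(a',a'')\in E^{j-1}\times E^{n-j}$, $S(a',\cdot,a''):=\{z_j\in E:(a',z_j,a'')\in S\}$. $\operatorname{int}S$ is the interior of $S$ in $\mathbb{C}^n$ and $\operatorname{int}_{\mathbb{C}}$ the interior in $\mathbb{C}$. A subset $S$ of a domain $\Omega$ does not separate domains in $\Omega$ if for every domain $U\subset\Omega$ the set $U\setminus S$ is connected. A function $f:T\setminus S\to\mathbb{C}$ is separately holomorphic on $T$ if for every $j\in\{1,\dots,n\}$ and every $(a',a'')\in(E^{j-1}\times E^{n-j})\setminus S_j$ the function $f(a',\cdot,a'')$, defined on $E\setminus S(a',\cdot,a'')$, extends to a holomorphic function on $E$. *)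

(* Defs.v *)
From mathcomp Require Import all_boot all_order all_algebra.
From mathcomp Require Import complex.
From mathcomp Require Import all_classical all_reals all_analysis.

Set Implicit Arguments.
Unset Strict Implicit.
Unset Printing Implicit Defensive.

Import Order.TTheory GRing.Theory Num.Theory.
Import numFieldNormedType.Exports.

Local Open Scope classical_set_scope.
Local Open Scope ring_scope.

(* R[i] packed as a numFieldType: the topology, the norm and the notion of
   differentiability are then those of a numFieldType over itself, so that
   [differentiable] below means C-differentiable. *)
Definition Cplx (R : realType) : numFieldType := R[i].

Section SeveralComplexVariables.
Context {R : realType}.
Local Notation C := (Cplx R).

Definition unit_disc : set C := [set w | `|w| < 1].

Definition polydisc (m : nat) : set 'rV[C]_m :=
  [set z | forall k : 'I_m, unit_disc (z ord0 k)].

Definition domain (m : nat) (U : set 'rV[C]_m) : Prop :=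
  [/\ open U, connected U & U !=set0].

Definition relatively_closed (m : nat) (Omega S : set 'rV[C]_m) : Prop :=
  exists2 F, closed F & S = Omega `&` F.

Definition does_not_separate_domains (m : nat) (Omega S : set 'rV[C]_m) : Prop :=
  forall U, domain U -> U `<=` Omega -> connected (U `\` S).

Definition holomorphic_on (V : normedModType C) (U : set V) (g : V -> C) : Prop :=
  forall z, U z -> differentiable g z.

(* A meromorphic function on Omega is presented as the pair (P, g) of its
   polar set P (poles and points of indeterminacy) and of the function g, which
   is holomorphic off P; the values of g on P are irrelevant.  The last clause
   says that P has no removable points, so that Omega `\` P is the full domain
   of holomorphy of g in Omega. *)
Definition meromorphic_on (m : nat) (Omega P : set 'rV[C]_m)
    (g : 'rV[C]_m -> C) : Prop :=
  [/\ relatively_closed Omega P /\ P° = set0,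
      holomorphic_on (Omega `\` P) g,
      (forall a, Omega a -> exists (U : set 'rV[C]_m) (phi psi : 'rV[C]_m -> C),
         [/\ domain U /\ U a, U `<=` Omega,
             holomorphic_on U phi /\ holomorphic_on U psi,
             (exists2 z, U z & psi z != 0)
           & forall z, (U `\` P) z -> psi z * g z = phi z])
    & (forall a, P a -> ~ exists (U : set 'rV[C]_m) (h : 'rV[C]_m -> C),
         [/\ open U /\ U a, U `<=` Omega, holomorphic_on U h
           & forall z, (U `\` P) z -> h z = g z])].

Section Slices.
Variable n : nat.
Implicit Types (S : set 'rV[C]_n) (j : 'I_n) (a : 'rV[C]_n.-1).

(* The point (a', w, a''), with w in position j, for a = (a', a''); its
   inverse operation (z', z_j, z'') |-> (z', z'') is [col' j]. *)
Definition insert_coord j a (w : C) : 'rV[C]_n :=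
  \row_k (if unlift j k is Some k' then a ord0 k' else w).

Definition fiber S j a : set C :=
  [set w | unit_disc w /\ S (insert_coord j a w)].

Definition fat_fibers S j : set 'rV[C]_n.-1 :=
  [set a | polydisc a /\ (fiber S j a)° !=set0].

Definition thin_lines S : set 'rV[C]_n :=
  \bigcup_(j : 'I_n) [set z | polydisc z /\ ~ fat_fibers S j (col' j z)].

(* Only the values of f on thin_lines S `\` S matter: for a outside
   fat_fibers S j the points insert_coord j a w, w in the disc, lie in
   thin_lines S. *)
Definition separately_holomorphic S (f : 'rV[C]_n -> C) : Prop :=
  forall j a, polydisc a -> ~ fat_fibers S j a ->
    exists2 g : C -> C, holomorphic_on unit_disc g &
      forall w, (unit_disc `\` fiber S j a) w -> g w = f (insert_coord j a w).

End Slices.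

End SeveralComplexVariables.

Arguments polydisc {R} m.

(* Main.v *)
(* In the first two coordinates (z_0, z_1), let S consist of the points with
   z_0 = 0 and |z_1| >= 1/2, or with z_1 = 0 and |z_0| >= 1/2.  It lies in the
   union of the coordinate hyperplanes, so it has empty interior and separates
   no domain.  The axis A = {z_0 = z_1 = 0} misses S.  A line through a point of
   A parallel to the z_0- or z_1-axis meets S in an annulus, so it is not one of
   the lines on which separate holomorphy is tested; every other line is either
   contained in A or disjoint from it.  Hence the indicator function of A is
   constant on every tested line.  It vanishes on a dense set, so a meromorphic
   extension would be 0, whereas its value on A is 1; since n >= 3, the set A is
   covered by tested lines, and the value 1 does count. *)
Require Import Defs.
From mathcomp Require Import all_boot all_order all_algebra.
From mathcomp Require Import complex.
From mathcomp Require Import all_classical all_reals all_analysis.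

Import Order.TTheory GRing.Theory Num.Theory.
Import numFieldNormedType.Exports.

Local Open Scope classical_set_scope.
Local Open Scope ring_scope.

(** * Connectedness of complements and of star-shaped sets *)

Lemma connected_between_closure (T : topologicalType) (G M : set T) :
  connected G -> G `<=` M -> M `<=` closure G -> connected M.
Proof.
move=> Gc GM MG B [b Bb] [C1 oC1 BE1] [C2 cC2 BE2].
have [Mb C1b] : (M `&` C1) b by rewrite -BE1.
have GE : G `&` C1 = G `&` C2.
  apply/seteqP; split=> x [Gx Cx]; split=> //.
    suff: (M `&` C2) x by case.
    by rewrite -BE2 BE1; split=> //; exact: GM.
  suff: (M `&` C1) x by case.
  by rewrite -BE1 BE2; split=> //; exact: GM.
(* By density [C1] meets [G], so connectedness puts all of [G] in [C1], hence in the closed set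
   [C2], which then contains [M]. *)
have GC1 : G `&` C1 = G.
  apply: Gc; [|by exists C1|by exists C2].
  exact: MG b Mb _ (open_nbhs_nbhs (conj oC1 C1b)).
rewrite BE2; apply/setIidl => x Mx; apply: cC2.
by apply: closure_subset (MG _ Mx); rewrite -GC1 GE => ? [].
Qed.

(** A nonempty relatively clopen part [B] of the complement contains [V \ S] as soon as it meets a
    good neighbourhood [V]. The points near which [B] is everything off [S] thus form a clopen
    subset [A] of [U]. *)
Lemma connected_setD_local (T : topologicalType) (U S : set T) :
  S° = set0 -> connected U ->
  (forall z, U z -> exists V, [/\ open V, V z, V `<=` U & connected (V `\` S)]) ->
  connected (U `\` S).
Proof.
move=> S0 Uc loc B [b Bb] [C1 oC1 BE1] [C2 cC2 BE2].
have VB V : connected (V `\` S) -> V `<=` U -> (V `&` B) !=set0 -> V `\` S `<=` B.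
  move=> Vc VU VB.
  have VBE C : B = (U `\` S) `&` C -> V `&` B = (V `\` S) `&` C.
    move=> ->; apply/seteqP; split=> x.
      by move=> [Vx [[_ nSx] Cx]].
    by move=> [[Vx nSx] Cx]; split=> //; split=> //; split=> //; exact: VU.
  rewrite -(Vc (V `&` B) VB).
  - by move=> x [].
  - by exists C1 => //; exact: VBE.
  - by exists C2 => //; exact: VBE.
pose A := [set z | exists V, [/\ open V, V z, V `<=` U & V `\` S `<=` B]].
have AU : A `<=` U by move=> z [V [_ Vz VU _]]; exact: VU.
have oA : open A.
  rewrite openE => z [V [oV Vz VU VSB]].
  by apply: filterS (open_nbhs_nbhs (conj oV Vz)) => y Vy; exists V.
have UA : U `&` closure A `<=` A.
  move=> z [Uz clz]; have [V [oV Vz VU Vc]] := loc z Uz.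
  exists V; split=> //; apply: VB => //.
  have [y [[W [oW Wy WU WSB]] Vy]] := clz _ (open_nbhs_nbhs (conj oV Vz)).
  (* Overlapping neighbourhoods also overlap off [S], because [S] has empty interior; this carries
     [B] from [W] to [V]. *)
  have [x [[Vx Wx] nSx]] : (V `&` W) `\` S !=set0.
    apply/set0P/eqP; rewrite setD_eq0 => VWS.
    suff: (S°) y by rewrite S0.
    apply: filterS VWS _; apply: open_nbhs_nbhs; split=> //; exact: openI.
  by exists x; split=> //; exact: WSB.
have AE : A = U.
  apply: Uc.
  - have [Ub nSb] : (U `\` S) b by move: Bb; rewrite BE1 => -[].
    have [V [oV Vb VU Vc]] := loc b Ub.
    by exists b, V; split=> //; apply: VB => //; exists b.
  - by exists A => //; rewrite setIidr.
  - exists (closure A); first exact: closed_closure.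
    apply/seteqP; split=> // x Ax; split; [exact: AU|exact: subset_closure].
apply/seteqP; split=> [x|x [Ux nSx]]; first by rewrite BE1 => -[].
have [V [_ Vx _ VSB]] : A x by rewrite AE.
exact: VSB.
Qed.

Lemma real_complex_continuous (R : realType) :
  continuous (fun t : R => (t%:C)%C : Cplx R).
Proof.
move=> t; apply/cvgrPdist_lt => -[e i] e0.
move: (e0); rewrite ltcE /= => /andP[/eqP-> {}e0].
near=> s.
rewrite -raddfB normc_def /= expr0n addr0 sqrtr_sqr ltcR.
by near: s; apply: cvgr_dist_lt => //; exact: cvg_id.
Unshelve. all: by end_near. Qed.

(** The set is a union of segments through [s]. They are parametrised by a real variable to use the
    connectedness of real intervals; in [R[i]], [0 <= t <= 1] already forces [t] to be real. *)
Lemma star_shaped_connected (R : realType) (V : normedModType (Cplx R))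
    (G : set V) (s : V) :
  (forall w (t : Cplx R), G w -> 0 <= t <= 1 -> G (w + t *: (s - w))) ->
  connected G.
Proof.
move=> Gs.
pose f w (t : R) : V := w + ((t%:C)%C : Cplx R) *: (s - w).
have -> : G = \bigcup_(w in G) (f w @` `[0, 1]%classic).
  apply/seteqP; split=> [w Gw|_ [w Gw [t + <-]]].
    exists w => //; exists 0; first by rewrite /= bound_itvE ler01.
    by rewrite /f rmorph0 scale0r addr0.
  rewrite /= in_itv /= => /andP[t0 t1]; apply: Gs => //.
  by rewrite -[0](rmorph0 (real_complex R)) -[1](rmorph1 (real_complex R)) !lecR t0.
apply: bigcup_connected => [|w Gw].
  exists s => w Gw; exists 1; first by rewrite /= bound_itvE ler01.
  by rewrite /f rmorph1 scale1r addrCA subrr addr0.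
apply: connected_continuous_connected; first exact: segment_connected.
apply: continuous_subspaceT => t; apply: cvgD; first exact: cvg_cst.
apply: cvgZr_tmp; exact: real_complex_continuous.
Qed.

(** * Sets inside the coordinate hyperplanes do not separate domains *)

(* In R[i], [x <= 0] means that x is a nonpositive real number, so each coordinate
   is kept off the ray from 0 through - s_k.  This set is star-shaped around s and
   dense, and it misses the coordinate hyperplanes; its trace on a ball
   containing s shows that removing part of the hyperplanes leaves the ball connected. *)
Definition slit_polydomain {R : realType} {m : nat} (s : 'rV[Cplx R]_m) :
    set 'rV[Cplx R]_m :=
  [set z | forall k, ~~ (z ord0 k / s ord0 k <= 0)].

Lemma slit_polydomain_neq0 {R : realType} {m : nat} {s z : 'rV[Cplx R]_m} k :
  slit_polydomain s z -> z ord0 k != 0.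
Proof. by move=> /(_ k); apply: contraNneq => ->; rewrite mul0r. Qed.

(** For [w = z_k / s_k] the new quotient is [(1 - t) * w + t]. If it is nonpositive, then
    [(1 - t) * w <= - t], which is absurd for [t = 1] and gives [w <= 0] otherwise. *)
Lemma slit_polydomain_star {R : realType} {m : nat} {s z : 'rV[Cplx R]_m}
    {t : Cplx R} :
  (forall k, s ord0 k != 0) -> slit_polydomain s z -> 0 <= t <= 1 ->
  slit_polydomain s (z + t *: (s - z)).
Proof.
move=> s0 Gz /andP[t0 t1] k; apply: contra (Gz k).
rewrite !mxE mulrDl -mulrA mulrBl divff//.
set w := _ / _ => le0.
have tw : (1 - t) * w <= - t.
  by rewrite -subr_le0 opprK (le_trans _ le0)// mulrBr mulr1 mulrBl mul1r addrAC addrA.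
have [t1E|tn1] := eqVneq t 1.
  by move: tw; rewrite t1E subrr mul0r oppr_ge0 ler10.
rewrite -(pmulr_rle0 _ (x := 1 - t)) ?subr_gt0 ?lt_neqAle ?tn1//.
by rewrite (le_trans tw)// oppr_le0.
Qed.

Lemma slit_polydomain_dense {R : realType} {m : nat} {s : 'rV[Cplx R]_m} :
  (forall k, s ord0 k != 0) -> dense (slit_polydomain s).
Proof.
move=> s0 O [z Oz] oO.
have /nbhs_ballP[e e0 zeO] : nbhs z O by exact: open_nbhs_nbhs.
pose i : Cplx R := Complex 0 1.
pose d k : Cplx R := e / 2 / `|s ord0 k|.
have d0 k : 0 < d k by rewrite divr_gt0 ?normr_gt0// divr_gt0.
(* A bad quotient [z_k / s_k] is moved off the real axis by [d k * i]; this displaces the coordinate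
   by exactly [e / 2]. *)
exists (\row_k (z ord0 k +
  (if z ord0 k / s ord0 k <= 0 then d k * i * s ord0 k else 0))); split.
  apply: zeO; split=> // j k; rewrite ord1 mxE -ball_normE /=.
  rewrite opprD addrA subrr sub0r normrN.
  case: ifP => _; last by rewrite normr0.
  have -> : `|d k * i * s ord0 k| = e / 2.
    rewrite 2!normrM (gtr0_norm (d0 k)) (_ : `|i| = 1) ?mulr1 ?divfK ?normr_eq0//.
    by rewrite normc_def /= expr0n add0r expr1n sqrtr1.
  by rewrite ltr_pdivrMr// ltr_pMr// ltr1n.
move=> k; rewrite mxE; case: ifP => [le0|/negbT]; last by rewrite addr0.
rewrite mulrDl mulfK//; move: le0 (d0 k); rewrite !lecE ltcE.
case: (_ / _) => a b /= /andP[/eqP<- _]; case: (d k) => x y /=.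
move=> /andP[/eqP-> x0]; rewrite !(mulr0, mul0r, mulr1, add0r, addr0, subr0).
by rewrite negb_and lt_eqF.
Qed.

Lemma coordinate_hyperplanes_nonseparating {R : realType} {m : nat}
    (Omega : set 'rV[Cplx R]_m) {S : set 'rV[Cplx R]_m} :
  S `<=` [set z | exists k, z ord0 k = 0] ->
  S° = set0 /\ does_not_separate_domains Omega S.
Proof.
move=> SZ.
have GS s : slit_polydomain s `<=` ~` S.
  by move=> z Gz /SZ [k zk0]; move: (slit_polydomain_neq0 k Gz); rewrite zk0 eqxx.
have S0 : S° = set0.
  rewrite -subset0 => z Sz.
  pose s : 'rV[Cplx R]_m := const_mx 1.
  have s0 k : s ord0 k != 0 by rewrite mxE oner_neq0.
  have [y [/interior_subset Sy Gy]] := slit_polydomain_dense s0 _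
    (ex_intro _ z Sz) (@open_interior _ S).
  exact: (GS s y Gy Sy).
split=> // U [oU Uc _] _; apply: connected_setD_local => // c Uc'.
have /nbhs_ballP[r r0 crU] : nbhs c U by exact: open_nbhs_nbhs.
have ocr : open (ball c r) by exact: ball_open.
exists (ball c r); split=> //; first exact: ballxx.
(* The centre must stay in the ball and have no zero coordinate. *)
pose s : 'rV[Cplx R]_m := \row_k (if c ord0 k == 0 then r / 2 else c ord0 k).
have s0 k : s ord0 k != 0.
  by rewrite mxE; case: ifPn => // _; rewrite mulf_neq0 ?invr_neq0 ?gt_eqF.
have cs : ball c r s.
  split=> // j k; rewrite ord1 mxE; case: ifPn => [/eqP ->|_]; last exact: ballxx.
  rewrite -ball_normE /= sub0r normrN gtr0_norm ?divr_gt0//.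
  by rewrite ltr_pdivrMr// ltr_pMr// ltr1n.
apply: (@connected_between_closure _ (ball c r `&` slit_polydomain s)).
- apply: (@star_shaped_connected _ _ _ s) => w t [cw Gw] t01.
  split; last exact: slit_polydomain_star.
  move: cs cw; rewrite mx_norm_ball /ball_ /= => cs cw.
  have -> : c - (w + t *: (s - w)) = t *: (c - s) + (1 - t) *: (c - w).
    rewrite scalerBl scale1r addrCA -scalerBr [c - s - _]addrC opprB subrKA.
    by rewrite -[w - s]opprB scalerN opprD addrA.
  move/andP: t01 => [t0 t1].
  rewrite (le_lt_trans (ler_normD _ _))// !normrZ ger0_norm// ger0_norm ?subr_ge0//.
  (* For [t = 1] strictness comes from [s] being in the ball, otherwise from [w]. *)
  have [->|tn1] := eqVneq t 1; first by rewrite mul1r subrr mul0r addr0.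
  have -> : r = t * r + (1 - t) * r by rewrite -mulrDl addrC subrK mul1r.
  apply: ler_ltD; first by rewrite ler_wpM2l// ltW.
  by rewrite ltr_pM2l// subr_gt0 lt_neqAle tn1.
- by move=> z [cz Gz]; split=> //; exact: (GS s).
- move=> z [cz _] B Bz.
  have [y [[cy By] Gy]] : (ball c r `&` B°) `&` slit_polydomain s !=set0.
    apply: slit_polydomain_dense => //.
      by exists z; split.
    exact: openI ocr (@open_interior _ B).
  by exists y; split; [split|exact: interior_subset].
Qed.

(** * Lines parallel to the axes, the truncated cross and the axis indicator *)

Lemma insert_coord_id {R : realType} {n : nat} (j : 'I_n) (a : 'rV[Cplx R]_n.-1) w :
  insert_coord j a w ord0 j = w.
Proof. by rewrite mxE unlift_none. Qed.

Lemma insert_coord_neq {R : realType} {n : nat} (j k : 'I_n)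
    (a : 'rV[Cplx R]_n.-1) w w' :
  j != k -> insert_coord j a w ord0 k = insert_coord j a w' ord0 k.
Proof. by move=> jk; rewrite !mxE; have [k' -> ->] := unlift_some jk. Qed.

Lemma insert_coord_col' {R : realType} {n : nat} (j k : 'I_n)
    (z : 'rV[Cplx R]_n) w :
  j != k -> insert_coord j (col' j z) w ord0 k = z ord0 k.
Proof. by move=> jk; rewrite !mxE; have [k' -> ->] := unlift_some jk; rewrite mxE. Qed.

Section Counterexample.
Context {R : realType} {n : nat}.
Context (i0 i1 i2 : 'I_n).
Context (i01 : i0 != i1) (i20 : i2 != i0) (i21 : i2 != i1).
Local Notation C := (Cplx R).

Definition half_hyperplane (k l : 'I_n) : set 'rV[C]_n :=
  [set z | z ord0 k = 0 /\ ~ `|z ord0 l| < 2^-1].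

Definition truncated_cross : set 'rV[C]_n :=
  polydisc n `&` (half_hyperplane i0 i1 `|` half_hyperplane i1 i0).

Definition axis_indicator (z : 'rV[C]_n) : C :=
  if (z ord0 i0 == 0) && (z ord0 i1 == 0) then 1 else 0.

Lemma half_hyperplane_closed k l : closed (half_hyperplane k l).
Proof.
apply: closedI.
  apply: (@preimage_closed _ _ (fun z : 'rV[C]_n => z ord0 k) [set 0]).
    by move=> z _; exact: coord_continuous.
  exact/accessible_closed_set1/hausdorff_accessible/norm_hausdorff.
apply: (@preimage_closed _ _ (fun z : 'rV[C]_n => z ord0 l) [set w | ~ `|w| < 2^-1]).
  by move=> z _; exact: coord_continuous.
rewrite -openC; have -> : ~` [set w : C | ~ `|w| < 2^-1] = ball 0 2^-1.
  rewrite -ball_normE; apply/seteqP; split=> w /=; rewrite sub0r normrN.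
    by move/contrapT.
  by move=> w2 nw2.
exact: ball_open.
Qed.

Lemma fat_fibers_truncated_cross (k l : 'I_n) (a : 'rV[C]_n.-1) w :
  k != l -> half_hyperplane l k `<=` half_hyperplane i0 i1 `|` half_hyperplane i1 i0 ->
  polydisc n.-1 a -> insert_coord k a w ord0 l = 0 -> fat_fibers truncated_cross k a.
Proof.
move=> kl sub Ea al; split=> //.
have q0 : (0 : C) < 4^-1 by rewrite invr_gt0.
(* The disc of radius 1/4 about 3/4 just fits into the annulus of moduli from 1/2 to 1. *)
exists (3 / 4 : C); apply/nbhs_ballP; exists 4^-1 => // v; rewrite -ball_normE /= => dv.
have q34 : `|3 / 4 : C| = 3 / 4 by rewrite ger0_norm// divr_ge0.
have v1 : `|v| < 1.
  have -> : v = 3 / 4 - (3 / 4 - v) by rewrite subKr.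
  rewrite (le_lt_trans (ler_normB _ _))// q34.
  rewrite (lt_le_trans (_ : _ < 3 / 4 + 4^-1))// ?ltrD2l//.
  by rewrite -[X in _ + X]mul1r -mulrDl natr1 divff.
split=> //; split.
  move=> j; have [->|kj] := eqVneq j k; first by rewrite /unit_disc insert_coord_id.
  rewrite /unit_disc /insert_coord mxE; rewrite eq_sym in kj.
  by have [j' _ ->] := unlift_some kj; exact: Ea.
apply: sub; split; first by rewrite -al; exact: insert_coord_neq.
rewrite insert_coord_id => v2.
suff: `|3 / 4 : C| < 3 / 4 by rewrite q34 ltxx.
rewrite -[X in `|X|](subrK v) (le_lt_trans (ler_normD _ _))//.
rewrite (lt_le_trans (ltrD dv v2))//.
have -> : (2^-1 : C) = 2 / 4 by rewrite -[4]/(2 * 2)%:R natrM invfM mulrA divff ?mul1r.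
by rewrite -[X in X + _]mul1r -mulrDl nat1r.
Qed.

Lemma truncated_cross_fiber0 (j : 'I_n) (a : 'rV[C]_n.-1) :
  (forall w, ~ truncated_cross (insert_coord j a w)) ->
  ~ fat_fibers truncated_cross j a.
Proof. by move=> nS [_ [w /interior_subset [_ /nS]]]. Qed.

Lemma axis_indicator_separately_holomorphic :
  separately_holomorphic truncated_cross axis_indicator.
Proof.
move=> j a Ea nfat.
(* Constancy holds on the whole line, including its points in the cross, so a constant function
   serves as the extension. *)
suff fE w w' : axis_indicator (insert_coord j a w) = axis_indicator (insert_coord j a w').
  exists (cst (axis_indicator (insert_coord j a 0))) => [w _|w _]; last exact: fE.
  exact: differentiable_cst.
rewrite /axis_indicator.
have [j0|j0] := eqVneq j i0.
  have [ai|ai] := eqVneq (insert_coord j a 0 ord0 i1) 0.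
    by case: nfat; apply: fat_fibers_truncated_cross ai; rewrite // j0// => z; right.
  by rewrite !(insert_coord_neq j i1 a _ 0) ?j0// -j0 (negPf ai) !andbF.
have [j1|j1] := eqVneq j i1.
  have [ai|ai] := eqVneq (insert_coord j a 0 ord0 i0) 0.
    by case: nfat; apply: fat_fibers_truncated_cross ai; rewrite // j1// => z; left.
  by rewrite !(insert_coord_neq j i0 a _ 0)// (negPf ai).
by rewrite !(insert_coord_neq j i0 a _ 0)// !(insert_coord_neq j i1 a _ 0).
Qed.

(** Agreement is only assumed off [P], so the origin could hide in [P]. Once [g] is known to vanish
    off [P], the zero function continues it across every point of [P], and the absence of removable
    points excludes this. *)
Lemma axis_indicator_no_meromorphic_extension
    (P : set 'rV[C]_n) (g : 'rV[C]_n -> C) :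
  meromorphic_on (polydisc n) P g ->
  ~ (forall z, (thin_lines truncated_cross `\` truncated_cross) z -> ~ P z ->
       g z = axis_indicator z).
Proof.
move=> [[[F cF PE] _] hol _ nrem] gf.
have oE : open (polydisc n : set 'rV[C]_n).
  have -> : polydisc n = ball (0 : 'rV[C]_n) 1.
    apply/seteqP; split=> z.
      move=> Ez; split=> // j k; rewrite ord1 mxE -ball_normE /= sub0r normrN.
      exact: Ez.
    move=> [_ Ez] k; move: (Ez ord0 k).
    by rewrite mxE -ball_normE /= sub0r normrN.
  exact: ball_open.
have oEP : open (polydisc n `\` P).
  have -> : polydisc n `\` P = polydisc n `&` ~` F.
    apply/seteqP; rewrite PE; split=> z [Ez nF]; split=> //; first by move=> Fz; apply: nF.
    by move=> [].
  by apply: openI => //; rewrite openC.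
have thin2 z : polydisc n z ->
    (forall w, ~ truncated_cross (insert_coord i2 (col' i2 z) w)) ->
    thin_lines truncated_cross z.
  by move=> Ez nS; exists i2 => //; split=> //; exact: truncated_cross_fiber0.
have g0 z : polydisc n z -> ~ P z -> g z = 0.
  move=> Ez nPz; apply/eqP; apply: contrapT => /negP gz0.
  pose s : 'rV[C]_n := const_mx 1.
  have s0 k : s ord0 k != 0 by rewrite mxE oner_neq0.
  have gc : {for z, continuous g} by exact/differentiable_continuous/hol.
  have nz : nbhs z (g @^-1` [set w | w != 0]).
    apply: gc; apply: open_nbhs_nbhs; split; last exact: gz0.
    have -> : [set w : C | w != 0] = ~` [set 0].
      by apply/seteqP; split=> w /= /eqP.
    apply: closed_openC; exact/accessible_closed_set1/hausdorff_accessible/norm_hausdorff.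
  have nz' : nbhs z ((polydisc n `\` P) `&` g @^-1` [set w | w != 0]).
    by apply: filterI => //; apply: open_nbhs_nbhs.
  (* Near [z] there is a point with all coordinates nonzero where [g] is still nonzero; its
     [i2]-line misses the cross, so [g] equals the indicator there, which is 0. *)
  have [y [/interior_subset[[Ey nPy] gy0] Gy]] := slit_polydomain_dense s0 _
    (ex_intro _ z nz') (@open_interior _ _).
  have y0 k := slit_polydomain_neq0 k Gy.
  move: gy0 => /=; rewrite gf//.
    by rewrite /axis_indicator (negPf (y0 _)) eqxx.
  split; last by move=> [_ [|] [/eqP]]; rewrite (negPf (y0 _)).
  apply: thin2 => // w [_ [|] [/eqP]];
    by rewrite insert_coord_col'// (negPf (y0 _)).
have E0 : polydisc n (0 : 'rV[C]_n) by move=> k; rewrite /unit_disc /= mxE normr0.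
have h2 : `|0 : C| < 2^-1 by rewrite normr0 invr_gt0.
have P0 : ~ P 0.
  move=> P0; apply: (nrem 0 P0); exists (polydisc n), (cst 0).
  by split=> [||z _|z [Ez nPz]] //; rewrite g0.
have := g0 0 E0 P0; rewrite gf//.
  by rewrite /axis_indicator !mxE eqxx => /eqP; rewrite oner_eq0.
(* The [i2]-line through the origin stays in the axis, where the condition of modulus at least 1/2
   fails. *)
split; last by move=> [_ [|] [_]]; rewrite mxE.
apply: thin2 => // w [_ [|] [_]];
  by rewrite insert_coord_col'// mxE.
Qed.

End Counterexample.

Theorem propositionC (R : realType) (n : nat) (hn : (3 <= n)%N) :
  exists S : set 'rV[Cplx R]_n,
    [/\ relatively_closed (polydisc n) S,
        S° = set0,
        does_not_separate_domains (polydisc n) S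
      & exists f : 'rV[Cplx R]_n -> Cplx R,
          separately_holomorphic S f /\
          ~ exists (P : set 'rV[Cplx R]_n) (fhat : 'rV[Cplx R]_n -> Cplx R),
              meromorphic_on (polydisc n) P fhat /\
              (forall z, (thin_lines S `\` S) z -> ~ P z -> fhat z = f z)].
Proof.
have n0 : (0 < n)%N by exact: leq_trans hn.
have n1 : (1 < n)%N by exact: leq_trans hn.
pose i0 := Ordinal n0; pose i1 := Ordinal n1; pose i2 := Ordinal hn.
pose S : set 'rV[Cplx R]_n := truncated_cross i0 i1.
have [S0 Snsep] : S° = set0 /\ does_not_separate_domains (polydisc n) S.
  apply: coordinate_hyperplanes_nonseparating.
  by move=> z [_ [|] [zk _]]; [exists i0|exists i1].
exists S; split=> //.
  exists (half_hyperplane i0 i1 `|` half_hyperplane i1 i0) => //.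
  by apply: closedU; exact: half_hyperplane_closed.
exists (axis_indicator i0 i1); split; first exact: axis_indicator_separately_holomorphic.
by move=> [P [g [gmer]]]; exact: (axis_indicator_no_meromorphic_extension i0 i1 i2).
Qed.
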